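(* For all integers $m\ge 2$ and all $n\in\mathbb{N}$, we have $g_{2m}(n)=2n$ if and only if $n$ is prime, or $n=0$, or $(2m,n)=(6,6)$.
   Context: $\mathbb{N}=\{0,1,2,\dots\}$. For an integer $m\ge 2$, an $m$-product sequence is a finite sequence of integers $a_1\le a_2\le\dots\le a_t$ such that $\prod_{i=1}^t a_i=R^m$ for some $R\in\mathbb{N}$ and no integer appears more than $m-1$ times in the sequence. For $n\in\mathbb{N}$, $g_m(n)$ is the least integer $s$ such that there exists an $m$-product sequence $a_1\le\dots\le a_t$ with $a_1=n$ and $a_t=s$. *)

(* Defs.v *)
From mathcomp Require Import all_boot all_order all_algebra.
From mathcomp Require Import boolp classical_sets.

Set Implicit Arguments.
Unset Strict Implicit.
Unset Printing Implicit Defensive.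

Import Order.TTheory GRing.Theory Num.Theory.
Local Open Scope ring_scope.

Definition product_sequence (m : nat) (a : seq int) : Prop :=
  [/\ sorted <=%R a,
      exists r : nat, \prod_(x <- a) x = r%:Z ^+ m &
      forall x : int, (count_mem x a <= m - 1)%N].

Definition product_sequence_from_to (m n : nat) (s : int) : Prop :=
  exists a : seq int,
    product_sequence m (n%:Z :: a) /\ last n%:Z a = s.

Definition is_least (P : int -> Prop) (s : int) : Prop :=
  P s /\ forall s' : int, P s' -> s <= s'.

(* The default value 0 of xget is never used when 1 < m: see g_least. *)
Definition g (m n : nat) : int :=
  xget 0 [set s : int | is_least (product_sequence_from_to m n) s].

Lemma is_least_unique (P : int -> Prop) (s s' : int) :
  is_least P s -> is_least P s' -> s = s'.
Proof.
by move=> [Ps ls] [Ps' ls']; apply/eqP; rewrite eq_le ls ?ls'.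
Qed.

Lemma product_sequence_from_to_ge (m n : nat) (s : int) :
  product_sequence_from_to m n s -> n%:Z <= s.
Proof.
case=> a [[/= sa _ _] <-].
have /allP h := order_path_min le_trans sa.
by have := mem_last n%:Z a; rewrite inE => /predU1P[->|/h].
Qed.

Lemma product_sequence_from_to_exists (m n : nat) :
  (1 < m)%N -> exists s : int, product_sequence_from_to m n s.
Proof.
case: m => [//|[//|m]] _; case: n => [|n].
  exists 0, [::]; split=> //; split=> [//||x].
    by exists 0%N; rewrite big_seq1 expr0n.
  by rewrite /= addn0 subn1; case: (_ == _).
pose N := n.+1%:Z; pose M := N * 2 ^+ m.+2.
have ltNM : N < M.
  by rewrite /M ltr_pMr // exprn_egt1.
exists M, (rcons (nseq m N) M); split; last by rewrite last_rcons.
have -> : N :: rcons (nseq m N) M = rcons (nseq m.+1 N) M by [].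
split=> [||x].
- rewrite /= rcons_path; have -> : last N (nseq m N) = N by elim: (m).
  by rewrite (ltW ltNM) andbT; elim: (m) => //= k ->; rewrite lexx.
- exists (n.+1 * 2)%N.
  rewrite -cats1 big_cat big_seq1 big_nseq iter_mulr_1 PoszM exprMn.
  by rewrite [LHS]mulrA -exprSr.
- rewrite -cats1 count_cat count_nseq /= addn0 subn1 /=.
  rewrite -/N -/M; case: (eqVneq N x) => [<-|_].
    by rewrite gt_eqF // mul1n addn0.
  by rewrite mul0n add0n; case: (_ == _).
Qed.

Lemma g_least (m n : nat) :
  (1 < m)%N -> is_least (product_sequence_from_to m n) (g m n).
Proof.
move=> m_gt1.
suff [s ls] : exists s, is_least (product_sequence_from_to m n) s.
  by rewrite /g; case: xgetP => [x _ //|/(_ s)].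
have exP : exists k : nat, `[< product_sequence_from_to m n k%:Z >].
  have [s Ps] := product_sequence_from_to_exists n m_gt1.
  exists `|s|%N; apply/asboolP; rewrite gez0_abs //.
  exact: le_trans (product_sequence_from_to_ge Ps).
case: (ex_minnP exP) => k /asboolP Pk mink; exists k%:Z; split=> // s Ps.
have s0 : 0 <= s by exact: le_trans (product_sequence_from_to_ge Ps).
rewrite -(gez0_abs s0) lez_nat; apply: mink; apply/asboolP.
by rewrite gez0_abs.
Qed.

(* Main.v *)
(** Upper bounds on [g] come from explicit sequences, given by their values
    and multiplicities.  A composite [n = a b] with [a < b] and [n <> 6] starts
    the sequence [a b, a (b + 1), (a + 1) b, (a + 1) (b + 1)], whose product is
    a square and whose last term is less than [2 n]; taking every term [m] times
    gives a [2m]-th power.  For a prime [p >= 5] the same is done with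
    [p, 2 x ^ 2, 2 p], where [x] is the integer square root of [p].
    Lower bounds come from valuations: below [2 p], only [p] itself contributes
    to the valuation at the prime [p], and with fewer than [2m] copies this
    cannot be a multiple of [2m].  For [2m = n = 6], working modulo 2 with the
    valuation at 3, and modulo 3 with the valuations at 2 and 5, shows that the
    number of copies of 6 would be a multiple of 6. *)
Require Import Defs.
From mathcomp Require Import all_boot all_order all_algebra.
From mathcomp Require Import zify.

Import Order.TTheory GRing.Theory Num.Theory.
Local Open Scope ring_scope.

(** Each pair in [bs] is a value with its multiplicity. Expanding and sorting them yields an
    admissible sequence starting at [n]; since [g] is least, [t] need only bound its last term. *)
Lemma g_le_of_tally (M n t r : nat) (bs : seq (nat * nat)) :
  (1 < M)%N -> uniq (unzip1 bs) -> n \in unzip1 bs ->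
  all (fun b => (n <= b.1 <= t) && (0 < b.2 < M))%N bs ->
  (\prod_(b <- bs) b.1 ^ b.2 = r ^ M)%N -> g M n <= t%:Z.
Proof.
move=> M_gt1 bs_uniq n_bs bs_bounds bs_prod.
pose s := flatten [seq nseq b.2 b.1 | b <- bs].
have s_bounds x : x \in s -> (n <= x <= t)%N.
  case/flatten_mapP => b /(allP bs_bounds)/andP[bb _].
  by rewrite mem_nseq => /andP[_ /eqP->].
have n_s : n \in s.
  case/mapP: n_bs => b b_bs ->; apply/flatten_mapP; exists b => //.
  by rewrite mem_nseq eqxx andbT; case/andP: (allP bs_bounds _ b_bs) => _ /andP[].
have s_count x : (count_mem x s < M)%N.
  rewrite /s; elim: bs bs_uniq bs_bounds {n_bs bs_prod s s_bounds n_s}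
    => [|[y k] bs IH] /=; first by move=> _ _; lia.
  case/andP=> y_bs /IH{}IH /andP[/andP[_ /= k_lt] /IH{}IH].
  rewrite count_cat count_nseq /=; case: (eqVneq y x) => [yx|_]; last by rewrite mul0n add0n.
  suff -> : count_mem x (flatten [seq nseq b.2 b.1 | b <- bs]) = 0%N by lia.
  apply/count_memPn/negP => /flatten_mapP[b b_bs].
  rewrite mem_nseq => /andP[_ /eqP xb].
  by case/negP: y_bs; rewrite yx xb map_f.
have s_prod : (\prod_(x <- s) x = r ^ M)%N.
  rewrite -bs_prod /s big_flatten big_map; apply: eq_bigr => b _.
  by rewrite big_nseq iter_muln_1.
have s_sorted := sort_sorted leq_total s.
have mem_sort := mem_sort leq s.
case def_s: (sort leq s) => [|y a]; first by move: n_s; rewrite -mem_sort def_s.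
have yn : y = n.
  apply/eqP; rewrite eqn_leq; apply/andP; split; last first.
    by have /andP[] : (n <= y <= t)%N by rewrite s_bounds // -mem_sort def_s mem_head.
  move: s_sorted n_s; rewrite -mem_sort def_s /= => /(order_path_min leq_trans).
  by move/allP=> ymin; rewrite inE => /predU1P[->|/ymin].
subst y.
apply: le_trans (_ : (last n a)%:Z <= _); last first.
  by have /andP[] : (n <= last n a <= t)%N by rewrite s_bounds // -mem_sort def_s mem_last.
apply: (g_least n M_gt1).2; exists (map Posz a); split; last by rewrite last_map.
have -> : n%:Z :: map Posz a = map Posz (sort leq s) by rewrite def_s.
split.
- by rewrite sorted_map.
- exists r; have <- : (r ^ M)%N%:Z = r%:Z ^+ M.
    by elim: (M) => // k IH; rewrite expnS PoszM IH exprS.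
  rewrite big_map -s_prod (perm_big _ (permEl (perm_sort leq s))).
  by rewrite (big_morph Posz PoszM (erefl 1%:Z)).
- move=> x; rewrite count_map; case: x => k.
    rewrite (eq_count (a2 := pred1 k)) //.
    by rewrite (permP (permEl (perm_sort leq s))); have := s_count k; lia.
  by rewrite (eq_count (a2 := pred0)) // count_pred0.
Qed.

(** As [n] is positive, so are all terms; absolute values lose nothing, and valuations add up over
    the product. *)
Lemma product_sequence_from_to_logn (M n : nat) (s : int) :
  (0 < n)%N -> product_sequence_from_to M n s ->
  exists b : seq nat,
    [/\ forall x, x \in b -> (n <= x)%N /\ x%:Z <= s,
        (0 < count_mem n b <= M - 1)%N &
        forall p, (M %| \sum_(x <- b) logn p x)%N].
Proof.
move=> n_gt0 [a [[a_sorted [r a_prod] a_count] <-]].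
have a_ge x : x \in n%:Z :: a -> n%:Z <= x.
  rewrite inE => /predU1P[->//|].
  exact: (allP (order_path_min le_trans a_sorted)).
have a_le x : x \in n%:Z :: a -> x <= last n%:Z a.
  elim: (a) (n%:Z) a_sorted {a_prod a_count a_ge} x => [|z c IH] y /=.
    by move=> _ x; rewrite inE => /eqP->.
  case/andP=> yz /IH{}IH x; rewrite inE => /predU1P[->|/IH//].
  by apply: le_trans yz (IH _ (mem_head _ _)).
exists (map absz (n%:Z :: a)); split.
- move=> x /mapP[y ya ->]; have := a_ge y ya; have := a_le y ya.
  by move=> *; split; lia.
- rewrite count_map (eq_in_count (a2 := pred1 n%:Z)); last first.
    by move=> y /a_ge ny /=; lia.
  by rewrite a_count /= eqxx.
- move=> p.
  have prod_abs : (\prod_(x <- map absz (n%:Z :: a)) x = r ^ M)%N.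
    rewrite big_map -(big_morph absz abszM (erefl : `|1%Z|%N = 1%N)).
    by rewrite a_prod abszX.
  suff -> : (\sum_(x <- map absz (n%:Z :: a)) logn p x = logn p (r ^ M))%N.
    by rewrite lognX dvdn_mulr.
  rewrite -prod_abs big_seq_cond [in RHS]big_seq_cond.
  (* Positivity of the product is carried through the induction because [lognM] needs it. *)
  apply: (@proj1 _ (0 < \prod_(x <- map absz (n%:Z :: a) |
    (x \in map absz (n%:Z :: a)) && true) x)%N).
  elim/big_rec2: _ => [|x u v /andP[/mapP[y ya ->] _] [-> u_gt0]].
    by rewrite logn1.
  have y_gt0 : (0 < `|y|)%N by have := a_ge y ya; lia.
  by rewrite muln_gt0 lognM ?y_gt0.
Qed.

(** Turns divisibility of a sum of valuations into divisibility of the number of copies of [n]. *)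
Lemma sum_eq_count_mod (d n : nat) (b : seq nat) (f : nat -> nat) :
  (forall x, x \in b -> f x = (x == n) %[mod d])%N ->
  (\sum_(x <- b) f x = count_mem n b %[mod d])%N.
Proof.
move=> fE; rewrite -sum1_count [in RHS]big_mkcond /=.
elim: b fE => [|x b IH] fE; first by rewrite !big_nil.
rewrite !big_cons -modnDm fE ?mem_head // IH ?modnDm; last first.
  by move=> y yb; apply: fE; rewrite inE yb orbT.
by case: (x == n).
Qed.

Lemma g_ge_double_prime (M p : nat) :
  (1 < M)%N -> prime p -> (2 * p)%N%:Z <= g M p.
Proof.
move=> M_gt1 p_pr; have p_gt0 := prime_gt0 p_pr; rewrite leNgt; apply/negP => lt_g.
have [b [b_in cnt dv]] := product_sequence_from_to_logn _ _ _ p_gt0 (g_least p M_gt1).1.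
suff E : (\sum_(x <- b) logn p x = count_mem p b %[mod M])%N.
  have := dv p; rewrite /dvdn E modn_small; lia.
apply: sum_eq_count_mod => x /b_in[px xg]; congr (_ %% _)%N.
case: (eqVneq x p) => [->|xp]; first by rewrite logn_prime ?eqxx.
apply/eqP; rewrite -leqn0 leqNgt logn_gt0 mem_primes p_pr /=.
apply/negP => /andP[_ /dvdnP[k xE]].
have : (1 < k < 2)%N by subst x; apply/andP; split; nia.
by lia.
Qed.

Lemma g6_6_ge : 12%:Z <= g 6 6.
Proof.
rewrite leNgt; apply/negP => lt_g.
have [b [b_in cnt dv]] :=
  product_sequence_from_to_logn _ _ _ (isT : 0 < 6)%N (g_least 6 (isT : 1 < 6)%N).1.
have b_cases x : x \in b -> x \in [:: 6; 7; 8; 9; 10; 11]%N.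
  by case/b_in=> ? ?; rewrite !inE; lia.
(* Modulo 3 the valuation at 2 is nonzero only at 6 and 10, where it is 1; the term in [logn 5]
   cancels the contribution of 10. *)
have E3 : (\sum_(x <- b) (logn 2 x + 2 * logn 5 x) = count_mem 6 b %[mod 3])%N.
  apply: sum_eq_count_mod => x /b_cases; rewrite !inE.
  by do ![case/predU1P=> [->//|]]; move/eqP->.
have E2 : (\sum_(x <- b) logn 3 x = count_mem 6 b %[mod 2])%N.
  apply: sum_eq_count_mod => x /b_cases; rewrite !inE.
  by do ![case/predU1P=> [->//|]]; move/eqP->.
rewrite big_split -big_distrr /= in E3.
have [/dvdnP[i Ei] /dvdnP[j Ej] /dvdnP[k Ek]] := And3 (dv 2%N) (dv 3%N) (dv 5%N).
move: E2 E3 cnt; rewrite Ei Ej Ek; move: (count_mem _ b) => c; lia.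
Qed.

Lemma g_prime_le (m p : nat) :
  (2 <= m)%N -> prime p -> g (2 * m) p <= (2 * p)%N%:Z.
Proof.
move=> hm p_pr; have p_gt1 := prime_gt1 p_pr.
(* For [p] equal to 2 or 3 the square root [x] is 1 and [2 * x ^ 2] does not exceed [p], so these
   primes get their own tallies. *)
have [->|p_neq2] := eqVneq p 2%N.
  apply: (@g_le_of_tally _ _ _ 2 [:: (2, 2); (4, m.-1)]%N) => //=; try lia.
  rewrite !big_cons big_nil /= muln1.
  by rewrite -[4%N]/(2 ^ 2)%N -expnM -expnD; congr expn; lia.
have [->|p_neq3] := eqVneq p 3%N.
  apply: (@g_le_of_tally _ _ _ 6 [:: (3, 2 * m - 2); (4, m.-1); (6, 2)]%N) => //=; try lia.
  have E4 k : (4 ^ k = 2 ^ (2 * k))%N by rewrite expnM.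
  have E6 k : (6 ^ k = 2 ^ k * 3 ^ k)%N by rewrite -expnMn.
  rewrite !big_cons big_nil /= muln1 E4 !E6 mulnCA [(3 ^ _ * _)%N]mulnCA mulnA.
  by rewrite -!expnD; congr (expn _ _ * expn _ _)%N; lia.
have p_odd : odd p by case/even_prime: p_pr p_neq2 => ->.
have [x [x2p p2x]] : exists x, (x ^ 2 <= p /\ p < x.+1 ^ 2)%N.
  elim: (p) => [|k [x [? ?]]]; first by exists 0%N.
  have [|] := leqP (x.+1 ^ 2) k.+1; last by exists x; split; lia.
  by exists x.+1; split=> //; nia.
have p_neq_sq : p != (x ^ 2)%N.
  apply/eqP => pE; have /(primeP p_pr).2/orP[/eqP|/eqP] : (x %| p)%N; try nia.
  by rewrite pE -mulnn dvdn_mulr.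
have p_bound : (p < 2 * x ^ 2 < 2 * p)%N.
  have neq : p != (2 * x ^ 2)%N by apply/eqP => pE; move: p_odd; rewrite pE oddM.
  have p_gt4 : (4 < p)%N.
    by case: (p) p_pr p_gt1 p_neq2 p_neq3 => [|[|[|[|[|k]]]]].
  (* From [x = 3] on, [x.+1 ^ 2 <= 2 * x ^ 2]. For [x = 2], [p] is below 9 and differs from 8. *)
  have [|x_ge3] := leqP x 2; last by nia.
  by case: x x2p p2x p_neq_sq neq => [|[|[|]]] //=; lia.
apply: (@g_le_of_tally _ _ _ (2 * p * x)
  [:: (p, m); (2 * x ^ 2, m); (2 * p, m)]%N) => /=; rewrite ?inE ?eqxx //=; try lia.
rewrite !big_cons big_nil /= muln1 expnM -!expnMn; congr expn; nia.
Qed.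

Lemma g_composite_lt (m a b : nat) :
  (2 <= m)%N -> (1 < a <= b)%N -> (a * b != 6)%N ->
  g (2 * m) (a * b) < (2 * (a * b))%N%:Z.
Proof.
move=> hm /andP[a_gt1 ab] n_neq6.
have M_gt1 : (1 < 2 * m)%N by lia.
have [<-|a_neq_b] := eqVneq a b.
  apply: (@le_lt_trans _ _ (a * a)%N%:Z); last by nia.
  apply: (@g_le_of_tally _ _ _ a [:: (a * a, m)]%N) => /=; rewrite ?inE ?eqxx //=; try lia.
  by rewrite big_seq1 /= mulnn -expnM.
(* Equivalent to [(a - 1) * (b - 1) > 2], which for [1 < a < b] fails only at [a = 2], [b = 3]. *)
have dom : (a.+1 * b.+1 < 2 * (a * b))%N.
  by have [a2|a_neq2] := eqVneq a 2%N; [subst a; lia | nia].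
apply: (@le_lt_trans _ _ (a.+1 * b.+1)%N%:Z); last by [].
apply: (@g_le_of_tally _ _ _ (a * b * (a.+1 * b.+1))
  [:: (a * b, m); (a * b.+1, m); (a.+1 * b, m); (a.+1 * b.+1, m)]%N);
  rewrite //= ?inE ?eqxx //; try nia.
by rewrite !big_cons big_nil /= muln1 expnM -!expnMn; congr expn; nia.
Qed.

(** The values 6, 8, 9 suffice. Six copies of 6 are allowed once [m >= 4]; for [m = 2] two copies
    work. *)
Lemma g6_lt (m : nat) : (2 <= m)%N -> m != 3 -> g (2 * m) 6 < 12%:Z.
Proof.
move=> hm m_neq3.
apply: (@le_lt_trans _ _ 9%:Z) => //.
have [->|m_neq2] := eqVneq m 2%N.
  apply: (@g_le_of_tally _ _ _ 12 [:: (6, 2); (8, 2); (9, 1)]%N) => //.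
  by rewrite !big_cons big_nil.
apply: (@g_le_of_tally _ _ _ (2 ^ 3 * 3 ^ 2)
  [:: (6, 6); (8, 2 * m - 2); (9, 2 * m - 3)]%N) => //=; try lia.
have E6 k : (6 ^ k = 2 ^ k * 3 ^ k)%N by rewrite -expnMn.
have E8 k : (8 ^ k = 2 ^ (3 * k))%N by rewrite expnM.
have E9 k : (9 ^ k = 3 ^ (2 * k))%N by rewrite expnM.
rewrite !big_cons big_nil /= muln1 E6 E8 E9 expnMn -!expnM mulnACA -!expnD.
by congr (expn _ _ * expn _ _)%N; lia.
Qed.

Theorem theorem4p13 (m n : nat) (hm : (2 <= m)%N) :
  g (2 * m)%N n = (2 * n)%N%:Z <->
  (prime n \/ n = 0%N \/ ((2 * m)%N, n) = (6%N, 6%N)).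
Proof.
have M_gt1 : (1 < 2 * m)%N by lia.
split=> [gE|[n_pr|[->|[-> ->]]]].
- have [n_pr|n_npr] := boolP (prime n); [by left | right].
  have [n0|n_gt0] := posnP n; [by left | right].
  have [n1|n_neq1] := eqVneq n 1%N.
    suff : g (2 * m) 1 <= 1%:Z by rewrite n1 in gE; rewrite gE.
    apply: (@g_le_of_tally _ _ _ 1 [:: (1, 1)]%N) => //=; first by lia.
    by rewrite big_seq1 !exp1n.
  have [n6|n_neq6] := eqVneq n 6%N.
    have [->|m_neq3] := eqVneq m 3%N; first by rewrite n6.
    by have := g6_lt m hm m_neq3; rewrite n6 in gE; rewrite gE.
  case/primePn: n_npr => [|[d d_bounds /dvdnP[e nE]]]; first by lia.
  have [a [b [ab abE]]] : exists a b, (1 < a <= b /\ a * b = n)%N.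
    (* The divisor and its cofactor are ordered so that the smaller one comes first. *)
    have [de|ed] := leqP d e.
      by exists d, e; split; [lia | rewrite nE mulnC].
    by exists e, d; split=> //; nia.
  by have := @g_composite_lt m a b hm ab; rewrite abE gE ltxx => /(_ n_neq6).
- by apply/eqP; rewrite eq_le g_prime_le // g_ge_double_prime.
- apply/eqP; rewrite eq_le; apply/andP; split.
    apply: (@g_le_of_tally _ _ _ 0 [:: (0, 1)]%N) => //=; first by lia.
    by rewrite big_seq1 !exp0n //; lia.
  exact: product_sequence_from_to_ge (g_least 0 M_gt1).1.
- apply/eqP; rewrite eq_le g6_6_ge andbT.
  (* The valuations at 2 are 1 + 3 + 0 + 2 and those at 3 are 1 + 0 + 4 + 1, both 6. *)
  apply: (@g_le_of_tally _ _ _ 6 [:: (6, 1); (8, 1); (9, 2); (12, 1)]%N) => //.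
  by rewrite !big_cons big_nil.
Qed.
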